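(* Let $Q\in\mathbb{R}^{n\times n}$ be symmetric positive definite, $r\in\mathbb{R}^n$, $\Delta>0$, and let $W_r$, $W^{\mathrm q}_{r,\Delta}$, $M_Q$ and $M_\nu(n)$ be as in the context. For every $z\in\{0,1\}^n$, $$\left|W_r(z)-W^{\mathrm q}_{r,\Delta}(z)\right|\le\frac{\Delta}{2}M_Q.$$ If $Q$ has half-bandwidth at most $\nu$ (where $0\le\nu\le n-1$), then $M_Q\le M_\nu(n)$ and hence, for every $z\in\{0,1\}^n$, $$\left|W_r(z)-W^{\mathrm q}_{r,\Delta}(z)\right|\le\frac{\Delta}{2}M_\nu(n).$$
   Context: For $r\in\mathbb{R}^n$: $y_i=0$ if $r_i\ge0$ and $y_i=1$ otherwise; $s_i=1-2y_i$; $a=r-s$. Let $\alpha_i=2s_i(Qa)_i+2Q_{ii}$ and $\beta_{ij}=4s_is_jQ_{ij}$ for $i<j$. Let $\mathcal{E}_Q=\{\{i,j\}:1\le i<j\le n,\ Q_{ij}\ne0\}$ and $$W_r(z)=\sum_{i=1}^n\alpha_iz_i+\sum_{\{i,j\}\in\mathcal{E}_Q}\beta_{ij}z_iz_j.$$ Quantized coefficients: $\widetilde\alpha_i=\lfloor\alpha_i/\Delta\rceil$ and $\widetilde\beta_{ij}=\lfloor\beta_{ij}/\Delta\rceil$ for $\{i,j\}\in\mathcal{E}_Q$, where $\lfloor\cdot\rceil$ is rounding to a nearest integer with a fixed deterministic convention for half-integer ties. Define $$\widetilde W_{r,\Delta}(z)=\sum_i\widetilde\alpha_iz_i+\sum_{\{i,j\}\in\mathcal{E}_Q}\widetilde\beta_{ij}z_iz_j,\qquad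 W^{\mathrm q}_{r,\Delta}(z)=\Delta\widetilde W_{r,\Delta}(z).$$ Also $M_Q=n+|\mathcal{E}_Q|$ and $M_\nu(n)=n+\sum_{d=1}^\nu(n-d)=n(\nu+1)-\nu(\nu+1)/2$. $Q$ has half-bandwidth at most $\nu$ if $Q_{ij}=0$ whenever $|i-j|>\nu$. *)

(* Defs.v *)
From mathcomp Require Import all_boot all_order all_algebra.
From mathcomp Require Import reals ring.

Set Implicit Arguments.
Unset Strict Implicit.
Unset Printing Implicit Defensive.

Import Order.TTheory GRing.Theory Num.Theory.
Local Open Scope ring_scope.

Definition sym_posdef (R : realType) (n : nat) (Q : 'M[R]_n) : Prop :=
  Q^T = Q /\ forall x : 'cV[R]_n, x != 0 -> 0 < (x^T *m Q *m x) 0 0.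

(* The tie-breaking convention is whatever integer rnd picks at half-integers. *)
Definition nearest_rounding (R : realType) (rnd : R -> int) : Prop :=
  forall (x : R) (k : int), `|x - (rnd x)%:~R| <= `|x - k%:~R|.

Definition half_bandwidth_le (R : realType) (n : nat) (Q : 'M[R]_n) (nu : nat) :
    Prop :=
  forall i j : 'I_n, (nu < `|i - j|)%N -> Q i j = 0.

Section Potential.
Variables (R : realType) (n : nat) (Q : 'M[R]_n) (r : 'cV[R]_n).

Definition hard_bits : 'cV[R]_n := \col_i (if 0 <= r i 0 then 0 else 1).
Definition signs : 'cV[R]_n := \col_i (1 - 2 * hard_bits i 0).
Definition residual : 'cV[R]_n := r - signs.

Definition alpha (i : 'I_n) : R :=
  2 * signs i 0 * (Q *m residual) i 0 + 2 * Q i i.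

Definition beta (i j : 'I_n) : R := 4 * signs i 0 * signs j 0 * Q i j.

(* The unordered pair {i, j} is represented by (i, j) with i < j. *)
Definition edges : {set 'I_n * 'I_n} :=
  [set p : 'I_n * 'I_n | (p.1 < p.2)%N && (Q p.1 p.2 != 0)].

Definition W (z : {ffun 'I_n -> bool}) : R :=
  \sum_i alpha i * (z i)%:R
  + \sum_(p in edges) beta p.1 p.2 * (z p.1)%:R * (z p.2)%:R.

Section Quantized.
Variables (rnd : R -> int) (Delta : R).

Definition alphaq (i : 'I_n) : int := rnd (alpha i / Delta).
Definition betaq (i j : 'I_n) : int := rnd (beta i j / Delta).

Definition Wtilde (z : {ffun 'I_n -> bool}) : int :=
  \sum_i alphaq i * (z i)%:R
  + \sum_(p in edges) betaq p.1 p.2 * (z p.1)%:R * (z p.2)%:R.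

Definition Wq (z : {ffun 'I_n -> bool}) : R := Delta * (Wtilde z)%:~R.

End Quantized.

Definition num_terms : nat := (n + #|edges|)%N.

End Potential.

Definition num_terms_band (nu n : nat) : nat :=
  (n + \sum_(1 <= d < nu.+1) (n - d))%N.

Lemma num_terms_bandE (nu n : nat) : (nu <= n)%N ->
  (num_terms_band nu n)%:R
    = n%:R * (nu%:R + 1) - nu%:R * (nu%:R + 1) / 2 :> rat.
Proof.
rewrite /num_terms_band; elim: nu => [|nu IHnu] le_nu_n.
  by rewrite big_geq // addn0; field.
rewrite big_nat_recr //= addnA natrD IHnu ?(ltnW le_nu_n) // natrB //.
by rewrite -natr1; field.
Qed.

(* Main.v *)
Require Import Defs.
From mathcomp Require Import all_boot all_order all_algebra.
From mathcomp Require Import reals zify lra.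

Set Implicit Arguments.
Unset Strict Implicit.
Unset Printing Implicit Defensive.

Import Order.TTheory GRing.Theory Num.Theory.
Local Open Scope ring_scope.

(** Rounding to a nearest integer errs by at most 1/2, so rounding a coefficient on the grid of step
    [Delta] errs by at most [Delta / 2]. Since [z] is 0/1-valued, each monomial is 0 or 1, and by
    the triangle inequality the total error is at most [Delta / 2] per coefficient: [n] linear ones
    plus one per edge ([sum_quantization_error], used once for each kind). For a banded [Q], every
    edge lies on one of the superdiagonals 1 to [nu], and the d-th of these has at most [n - d]
    positions ([card_edges_band]). *)

Lemma nearest_rounding_error (R : realType) (rnd : R -> int) (x : R) :
  nearest_rounding rnd -> `|x - (rnd x)%:~R| <= 2^-1.
Proof.
move=> near_rnd.
have le_fl := floor_le x.
have lt_fl := floorD1_gt x.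
(* One of the two integers enclosing [x] is within 1/2 of it, and [rnd x] is at least as close,
   whatever the tie convention. *)
have [le_half|gt_half] := lerP (x - (Num.floor x)%:~R) 2^-1.
  apply: le_trans (near_rnd x (Num.floor x)) _.
  by rewrite ger0_norm // subr_ge0.
apply: le_trans (near_rnd x (Num.floor x + 1)) _.
rewrite ler0_norm; last by rewrite subr_le0 ltW.
rewrite intrD; lra.
Qed.

Lemma quantization_error (R : realType) (rnd : R -> int) (Delta x : R) :
  nearest_rounding rnd -> 0 < Delta ->
  `|x - Delta * (rnd (x / Delta))%:~R| <= Delta / 2.
Proof.
move=> near_rnd Delta_gt0.
rewrite -[X in X - _](mulfVK (lt0r_neq0 Delta_gt0)) mulrC -mulrBr normrM.
by rewrite gtr0_norm // ler_pM2l // nearest_rounding_error.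
Qed.

(** The errors add up termwise: a term with bit 1 contributes a single rounding error, a term with
    bit 0 contributes nothing. Leaving [I] and [P] general covers both the linear and the quadratic
    part. *)
Lemma sum_quantization_error (R : realType) (rnd : R -> int) (Delta : R)
    (I : finType) (P : pred I) (c : I -> R) (b : I -> bool) :
  nearest_rounding rnd -> 0 < Delta ->
  `|\sum_(i | P i) c i * (b i)%:R
    - Delta * (\sum_(i | P i) rnd (c i / Delta)%R * (b i)%:R)%:~R|
    <= Delta / 2 * #|P|%:R.
Proof.
move=> near_rnd Delta_gt0.
rewrite rmorph_sum /= mulr_sumr -sumrB.
apply: le_trans (ler_norm_sum _ _ _) _.
rewrite -sum1_card natr_sum mulr_sumr.
apply: ler_sum => i _.
rewrite rmorphM /= mulr1 mulrA -mulrA rmorph_nat mulrA -mulrBl normrM.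
case: (b i); first by rewrite normr1 mulr1 quantization_error.
by rewrite normr0 mulr0 divr_ge0 ?ltW.
Qed.

(** This counts the d-th superdiagonal of an n by n matrix; truncated subtraction gives 0 when [d]
    is at least [n]. *)
Lemma card_shifted_pairs (n d : nat) :
  (\sum_(p : 'I_n * 'I_n) (p.2 == p.1 + d :> nat) <= n - d)%N.
Proof.
rewrite -(pair_bigA _ (fun i j : 'I_n => (j == i + d :> nat)%N : nat)) /=.
(* Row [i] meets the superdiagonal only in column [i + d], which exists exactly when [i < n - d]. *)
apply: (@leq_trans (\sum_(i < n) (i < n - d)%N)).
  apply: leq_sum => i _.
  have [lt_id|ge_id] := ltnP (i + d) n.
    rewrite (bigD1 (Ordinal lt_id)) //= eqxx big1 => [|j]; first by lia.
    by rewrite -val_eqE /= => /negbTE ->.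
  by rewrite big1 // => j _; have := ltn_ord j; lia.
rewrite -(big_mkord xpredT (fun i => (i < n - d)%N : nat)).
rewrite (big_cat_nat (n := n - d)) ?leq_subr //=.
rewrite [X in (_ + X)%N]big_nat_cond [X in (_ + X)%N]big1 => [|i]; last first.
  by rewrite andbT => /andP[+ _]; rewrite ltnNge => ->.
rewrite addn0 -[leqRHS]subn0 -[leqRHS]muln1 -sum_nat_const_nat.
by apply: leq_sum => i _; case: (_ < _)%N.
Qed.

(** Double counting: after exchanging sums, each pair is weighted by the number of [d] in the range
    with [j = i + d], and an edge has weight at least 1 through [d = j - i]. *)
Lemma card_edges_band (R : realType) (n : nat) (Q : 'M[R]_n) (nu : nat) :
  Q^T = Q -> half_bandwidth_le Q nu ->
  (#|edges Q| <= \sum_(1 <= d < nu.+1) (n - d))%N.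
Proof.
move=> symQ bandQ.
apply: leq_trans (leq_sum _ (fun d _ => card_shifted_pairs n d)).
rewrite exchange_big /= -sum1_card big_mkcond /=.
apply: leq_sum => -[i j] _; rewrite inE /=.
case: ifP => // /andP[lt_ij Qij_neq0].
have le_nu : (j - i <= nu)%N.
  rewrite leqNgt; apply: contra Qij_neq0 => lt_nu.
  by rewrite -symQ mxE bandQ //; lia.
rewrite (big_rem (j - i)%N) ?mem_index_iota; last by lia.
by rewrite subnKC ?eqxx // ltnW.
Qed.

Theorem theoremB1 (R : realType) (n : nat) (Q : 'M[R]_n) (r : 'cV[R]_n)
    (Delta : R) (rnd : R -> int) :
  sym_posdef Q -> 0 < Delta -> nearest_rounding rnd ->
  (forall z : {ffun 'I_n -> bool},
     `|W Q r z - Wq Q r rnd Delta z| <= Delta / 2 * (num_terms Q)%:R) /\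
  (forall nu : nat, (nu < n)%N -> half_bandwidth_le Q nu ->
     (num_terms Q <= num_terms_band nu n)%N /\
     (forall z : {ffun 'I_n -> bool},
        `|W Q r z - Wq Q r rnd Delta z|
          <= Delta / 2 * (num_terms_band nu n)%:R)).
Proof.
move=> [symQ _] Delta_gt0 near_rnd.
have err z :
    `|W Q r z - Wq Q r rnd Delta z| <= Delta / 2 * (num_terms Q)%:R.
  rewrite /W /Wq /Wtilde intrD mulrDr opprD addrACA.
  apply: le_trans (ler_normD _ _) _.
  rewrite /num_terms natrD mulrDr lerD //.
    have := sum_quantization_error xpredT (alpha Q r) z near_rnd Delta_gt0.
    by rewrite card_ord.
  (* A product of two bits is again a bit, their conjunction, so the quadratic part has the same
     shape as the linear one. *)
  have := sum_quantization_error (mem (edges Q))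
    (fun p => beta Q r p.1 p.2) (fun p => z p.1 && z p.2) near_rnd Delta_gt0.
  under eq_bigr do rewrite -mulnb natrM mulrA.
  by under [X in Delta * X%:~R]eq_bigr do rewrite -mulnb natrM mulrA.
split=> // nu _ bandQ.
have le_terms : (num_terms Q <= num_terms_band nu n)%N.
  by rewrite leq_add2l card_edges_band.
split=> // z; apply: le_trans (err z) _.
by rewrite ler_wpM2l ?ler_nat // divr_ge0 ?ltW.
Qed.
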